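(* For every integer $\Delta\ge 1$ and every $\lambda>0$ there exists a non-decreasing function $F_{\Delta,\lambda}:[0,\infty)\to\mathbb{R}$ with $F_{\Delta,\lambda}(0)=0$ that is continuously differentiable on $(0,\infty)$ and satisfies, for every compact subset $\mathcal{K}\subset[0,1]$, $$\lim_{n\to\infty}\ \sup_{\mathbf{x}}\ \sup_{z\in[0,1]}\big|F_{n,\Delta,\lambda}(z\,|\,\mathbf{x})-F_{\Delta,\lambda}(z)\big|=0,$$ $$\lim_{n\to\infty}\ \sup_{\mathbf{x}}\ \sup_{z\in\mathcal{K}}\big|\dot F_{n,\Delta,\lambda}(z\,|\,\mathbf{x})-\dot F_{\Delta,\lambda}(z)\big|=0,$$ where $\sup_{\mathbf{x}}$ is over all boundary conditions $\mathbf{x}\in[0,1]^{\partial\mathbb{T}_{n,\Delta}}$ and a dot denotes the derivative in $z$.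
   Context: For integers $\Delta\ge1$, $n\ge0$, $\mathbb{T}_{n,\Delta}$ is the rooted tree of depth $n$ in which every node at distance less than $n$ from the root has exactly $\Delta$ children (so the root has degree $\Delta$ and other internal nodes have degree $\Delta+1$); its leaf set $\partial\mathbb{T}_{n,\Delta}$ is the set of nodes at distance $n$ from the root. For a finite simple graph $\mathbb{G}=(V,E)$ let $\mathcal{P}(\mathbb{G})=\{\mathbf{x}\in\mathbb{R}^V: x_u\ge0\ \forall u\in V,\ x_u+x_v\le1\ \forall (u,v)\in E\}$. For a finite Borel measure $\mu$ on $[0,1]$ (the free spin measure) the hardcore model on $\mathbb{G}$ is the probability measure $\mathbb{P}_{\mathbb{G},\mu}(A)=\mu^{\otimes V}(A)/\mu^{\otimes V}(\mathcal{P}(\mathbb{G}))$ for Borel $A\subset\mathcal{P}(\mathbb{G})$. The continuous hardcore model with activity $\lambda>0$ has free spin measure $\nu_\lambda(B)=\int_B\lambda^x\,dx$. $F_{n,\Delta,\lambda}(\cdot\,|\,\mathbf{x})$ is the cumulative distribution function of the spin at the root of $\mathbb{T}_{n,\Delta}$ under the continuous hardcore model, conditioned on the leaf spins being equal to $\mathbf{x}\in[0,1]^{\partial\mathbb{T}_{n,\Delta}}$. Explicitly, with $\mu=\nu_\lambda$ and $z\in[0,1]$: for $n=1$ and $\bar x=\max_{i}x_i$, $F_1(z|\mathbf{x})=\mu[0,\min(z,1-\bar x)]/\mu[0,1-\bar x]$ if $\bar x<1$, and $F_1(z|\mathbf{x})=1$ for all $z\in[0,1]$ if $\bar x=1$ (the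 root is forced to be $0$); for $n\ge2$, $$F_n(z|\mathbf{x})=\frac{\int_{[0,z]}\prod_{i=1}^{\Delta}F_{n-1}(1-t|\mathbf{x}^{i})\,\mu(dt)}{\int_{[0,1]}\prod_{i=1}^{\Delta}F_{n-1}(1-t|\mathbf{x}^{i})\,\mu(dt)},$$ where $\mathbf{x}^i$ is the restriction of $\mathbf{x}$ to the leaves of the subtree (a copy of $\mathbb{T}_{n-1,\Delta}$) rooted at the $i$-th child of the root. For $n\ge2$ this function has a continuous density on $[0,1]$, denoted $\dot F_{n,\Delta,\lambda}(\cdot|\mathbf{x})$. Derivatives at the endpoints of $[0,1]$ are understood as one-sided derivatives from inside $[0,1]$. *)

(* Defs.v *)
From HB Require Import structures.
From mathcomp Require Import all_boot all_order all_algebra.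
From mathcomp Require Import all_classical all_reals all_analysis measurable_realfun.

Set Implicit Arguments.
Unset Strict Implicit.
Unset Printing Implicit Defensive.

Import Order.TTheory GRing.Theory Num.Theory.
Import numFieldNormedType.Exports.

Local Open Scope classical_set_scope.
Local Open Scope ring_scope.

Section free_spin_measure.
Context {R : realType} (lambda : R).

Definition nu (B : set (measurableTypeR R)) : \bar R :=
  (\int[lebesgue_measure]_(x in B `&` `[0%R, 1%R]) (lambda `^ x)%:E)%E.

Let nu0 : nu set0 = 0%E.
Proof. by rewrite /nu set0I integral_set0. Qed.

Let nu_ge0 B : (0 <= nu B)%E.
Proof. by apply: integral_ge0 => x _; rewrite lee_fin powR_ge0. Qed.

Let nu_sigma_additive : semi_sigma_additive nu.
Proof.
move=> F mF tF mUF; rewrite /nu; apply: cvg_toP.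
  apply: ereal_nondecreasing_is_cvgn => m n mn.
  by apply: lee_sum_nneg_natr => // k _ _; exact: nu_ge0.
have mFI k : measurable (F k `&` (`[0, 1] : set (measurableTypeR R))).
  exact: measurableI.
rewrite setI_bigcupl ge0_integral_bigcup//=.
- apply/measurable_EFinP/(measurable_funS measurableT) => //.
  exact: measurable_powRr.
- by move=> x _; rewrite lee_fin powR_ge0.
- exact: trivIset_setIr.
Qed.

HB.instance Definition _ :=
  isMeasure.Build _ _ _ nu nu0 nu_ge0 nu_sigma_additive.

End free_spin_measure.

(* A node at distance k from the root of the Delta-ary tree is the word of
   length k listing the children followed on the path from the root; the leaf
   set of the tree of depth n is thus n.-tuple 'I_Delta. *)
Definition leaf (Delta n : nat) := n.-tuple 'I_Delta.

Definition boundary (R : realType) (Delta n : nat) (x : leaf Delta n -> R) :=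
  forall w, x w \in `[0, 1].

Definition subboundary (R : realType) (Delta n : nat)
    (x : leaf Delta n.+1 -> R) (i : 'I_Delta) : leaf Delta n -> R :=
  fun w => x (cons_tuple i w).

(* The CDF of the root spin given the leaf spins x, for the hardcore constraint
   x_u + x_v <= 1 along edges: a root spin t is compatible with child i with
   conditional weight root_cdf (subboundary x i) (1 - t). At depth 1, if some
   leaf spin is 1 then the root is forced to be 0.
   At depth 0 the root is itself the conditioned leaf, so its law is a point
   mass; the recursion does not use this value. *)
Fixpoint root_cdf (R : realType) (mu : {measure set (measurableTypeR R) -> \bar R})
    (Delta n : nat) : (leaf Delta n -> R) -> R -> R :=
  match n with
  | 0 => fun x z => if x [tuple] <= z then 1 else 0
  | m.+1 => fun x z =>
    if m is 0 then
      let xbar := \big[Num.max/0]_w x w in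
      if xbar < 1 then
        fine (mu `[0, Num.min z (1 - xbar)]%classic) /
        fine (mu `[0, 1 - xbar]%classic)
      else 1
    else
      let g t := \prod_(i < Delta) root_cdf mu (subboundary x i) (1 - t) in
      (\int[mu]_(t in `[0, z]) g t) / (\int[mu]_(t in `[0, 1]) g t)
  end.

Definition hc_cdf (R : realType) (Delta : nat) (lambda : R) (n : nat)
    (x : leaf Delta n -> R) (z : R) : R :=
  root_cdf (nu lambda) x z.

(* The derivative on [0, 1]: difference quotients only use points of [0, 1], so
   it is one-sided at 0 and at 1 and two-sided in between. *)
Definition quotient01 (R : realType) (f : R -> R) (z : R) :=
  (fun y : R => (f y - f z) / (y - z)) @ within `[0, 1] z^'.

Definition derivable01 (R : realType) (f : R -> R) (z : R) :=
  cvg (quotient01 f z).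

Definition derive01 (R : realType) (f : R -> R) (z : R) : R :=
  lim (quotient01 f z).

(* The supremum of a nonnegative quantity, in [0, +oo]; adding 0 only matters
   for A = set0, where the supremum is 0 and not -oo. *)
Definition esup0 (R : realType) (T : Type) (A : set T) (f : T -> \bar R) : \bar R :=
  ereal_sup (0%E |` (f @` A)).

(* Main.v *)
Require Import Defs.
From mathcomp Require Import all_boot all_order all_algebra.
From mathcomp Require Import all_classical all_reals all_analysis measurable_realfun.
From mathcomp Require Import ring lra.

Set Implicit Arguments.
Unset Strict Implicit.
Unset Printing Implicit Defensive.

Import Order.TTheory GRing.Theory Num.Theory.
Import numFieldNormedType.Exports.

Local Open Scope classical_set_scope.
Local Open Scope ring_scope.

(** For a weight h on [0, 1], let root_law h be the distribution function with
    density proportional to lambda^t h(1 - t). The recursion on the tree says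
    that the root law is root_law applied to the product of the laws at the
    children, so the question is the long-run behaviour of h |-> root_law (h^Delta).

    This map does not reverse the pointwise order of distribution functions,
    because of the normalisation, but it reverses the finer order where h1 is
    below h2 when h1 / h2 is nondecreasing (ratio_le): the densities are then
    ordered by likelihood ratio, and integration preserves a monotone ratio
    (root_law_antitone). The boundary conditions are therefore all caught between
    two deterministic sequences lo n and hi n, starting from the law of a root
    without neighbours and from the point mass at 0 (hc_cdf_bracket). Along
    these sequences lo increases and hi decreases; both are equi-Lipschitz, and
    their limits f <= g form a two-cycle f = root_law (g^Delta),
    g = root_law (f^Delta).

    There is no phase transition because every two-cycle is a fixed point. Put
    k(z) = g(1 - z) and let A, B be the normalising factors of f and g, so that
      f' = A lambda^z k^Delta,    k' = - B lambda^(1-z) f^Delta,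
      f(0) = k(1) = 0,            f(1) = k(0) = 1.
    Rescaling f and k by lambda^(-z/(Delta+1)) and lambda^(z/(Delta+1)) makes this
    system autonomous and Hamiltonian. Its Hamiltonian, written back in terms of
    f and k, is
      A lambda^z k^(Delta+1) + B lambda^(1-z) f^(Delta+1) - ln(lambda) f k,
    which equals A at 0 and B lambda^0 = B at 1; hence A = B
    (two_cycle_mass_eq). With equal normalising factors f <= g gives
    f = root_law (g^Delta) >= root_law (f^Delta) = g (lo_lim_eq_hi_lim).

    Uniformity comes for free from the normalisation: hi (n+1) - lo (n+1) is at
    most the ratio of the masses of hi(n)^Delta and lo(n)^Delta minus one, a
    numerical sequence tending to 0 (root_law_gap, cvg_gap). The densities are
    squeezed in the same way between explicit ones (density_squeeze). Finally the
    limit law extends past 1 as a C^1 function because its density is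
    proportional to lambda^z F(1 - z)^Delta, which vanishes at z = 1. *)

(** * Primitives of continuous functions *)

Section primitive.
Context {R : realType}.
Local Notation leb := (@lebesgue_measure R).
Implicit Types (w : R -> R) (z s t : R).

Lemma continuous_integrable_itv w a b :
  continuous w -> leb.-integrable `[a, b] (EFin \o w).
Proof.
move=> cw; apply: continuous_compact_integrable; first exact: segment_compact.
exact: continuous_subspaceT.
Qed.

Lemma ge0_derive_le (f df : R -> R) (a b : R) : a <= b ->
  (forall x, a <= x <= b -> is_derive x 1 f (df x)) ->
  (forall x, a <= x <= b -> 0 <= df x) -> f a <= f b.
Proof.
move=> ab fdf df0.
have cf : {within `[a, b], continuous f}.
  apply: derivable_within_continuous => x; rewrite in_itv/= => /fdf h.
  exact: ex_derive.
have [x xab|c] := @MVT_segment _ f df a b ab _ cf.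
  by apply: fdf; rewrite !ltW ?(itvP xab).
rewrite in_itv/= => cab fba.
by rewrite -subr_ge0 fba mulr_ge0 ?subr_ge0 ?df0.
Qed.

(** The two integrals start at -1 rather than 0 to make the primitive
    differentiable on both sides at 0; one-sided derivatives at the endpoints of
    [0, 1] then reduce to ordinary derivatives. *)
Definition primitive w z : R :=
  \int[leb]_(t in `[-1, z]) w t - \int[leb]_(t in `[-1, 0]) w t.

Lemma primitive0 w : primitive w 0 = 0.
Proof. by rewrite /primitive subrr. Qed.

Lemma is_derive_primitive w z : continuous w -> -1 < z ->
  is_derive z 1 (primitive w) (w z).
Proof.
move=> cw z1.
have [||||] := @continuous_FTC1_closed _ w (-1) z (z + 1) => //.
- by rewrite ltrDl.
- exact: continuous_integrable_itv.
- exact: cw.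
rewrite derive1E => d1 d2.
have h := DeriveDef d1 d2.
rewrite /primitive -[X in is_derive _ _ _ X]subr0.
exact: is_deriveB.
Qed.

Lemma primitiveE w z : continuous w -> 0 <= z ->
  primitive w z = \int[leb]_(t in `[0, z]) w t.
Proof.
move=> cw z0; rewrite /primitive Rintegral_itvB ?bnd_simp//.
- rewrite Rintegral_itv_obnd_cbnd//.
  apply: integrableS (continuous_integrable_itv 0 z cw) => //.
  by apply: subset_itvr; rewrite bnd_simp.
- exact: continuous_integrable_itv.
Qed.

Lemma le_primitive w1 w2 z : continuous w1 -> continuous w2 -> 0 <= z ->
  (forall t, 0 <= t <= z -> w1 t <= w2 t) -> primitive w1 z <= primitive w2 z.
Proof.
move=> c1 c2 z0 w12; rewrite -subr_ge0.
have := ge0_derive_le (f := fun x => primitive w2 x - primitive w1 x)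
  (df := fun x => w2 x - w1 x) z0; rewrite !primitive0 subrr; apply.
- move=> x /andP[x0 _]; apply: is_deriveB;
    by apply: is_derive_primitive => //; rewrite (lt_le_trans _ x0)// ltrN10.
- by move=> x /w12; rewrite subr_ge0.
Qed.

Lemma primitive_homo w s t : continuous w -> 0 <= s <= t ->
  (forall x, s <= x <= t -> 0 <= w x) -> primitive w s <= primitive w t.
Proof.
move=> cw /andP[s0 st] w0; apply: (ge0_derive_le (df := w)) => // x /andP[sx _].
by apply: is_derive_primitive => //; rewrite (lt_le_trans _ (le_trans s0 sx))// ltrN10.
Qed.

Lemma primitive_lipschitz w M s t : continuous w -> 0 <= s <= t ->
  (forall x, s <= x <= t -> w x <= M) ->
  primitive w t - primitive w s <= M * (t - s).
Proof.
move=> cw /andP[s0 st] wM.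
suff : M * s - primitive w s <= M * t - primitive w t by lra.
apply: (ge0_derive_le (f := fun x => M * x - primitive w x) (df := fun x => M * 1 - w x)) => //.
- move=> x /andP[sx _]; apply: is_deriveB.
  by apply: is_derive_primitive => //; rewrite (lt_le_trans _ (le_trans s0 sx))// ltrN10.
- by move=> x /wM; rewrite mulr1 subr_ge0.
Qed.

Lemma primitive_gt0 w z : continuous w -> 0 < z ->
  (forall t, 0 <= t <= z -> 0 <= w t) -> 0 < w 0 -> 0 < primitive w z.
Proof.
move=> cw z0 wge0 w0.
have : \forall t \near 0, w 0 / 2 < w t.
  by apply: cvgr_gt (cw 0) _ _; rewrite ltr_pdivrMr//; lra.
case/nbhs_ballP => d /= d0 dP.
(* On [0, e] the integrand stays above half its value at 0. *)
pose e := Num.min (d / 2) z.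
have e0 : 0 < e by rewrite lt_min divr_gt0.
have ez : e <= z by rewrite ge_min lexx orbT.
apply: (@lt_le_trans _ _ (primitive w e)); last first.
  apply: primitive_homo => // [|x /andP[ex xz]]; rewrite ?(ltW e0)//.
  by rewrite wge0// xz (le_trans (ltW e0)).
apply: (@lt_le_trans _ _ (w 0 / 2 * e)); first by rewrite mulr_gt0// divr_gt0.
rewrite -subr_ge0.
have := ge0_derive_le (f := fun x => primitive w x - w 0 / 2 * x)
  (df := fun x => w x - w 0 / 2 * 1) (ltW e0); rewrite primitive0 mulr0 subrr; apply.
- move=> x /andP[x0 _]; apply: is_deriveB.
  by apply: is_derive_primitive => //; rewrite (lt_le_trans _ x0)// ltrN10.
- move=> x /andP[x0 xe]; rewrite mulr1 subr_ge0 ltW//; apply: dP.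
  rewrite /ball/= sub0r normrN ger0_norm// (le_lt_trans xe)//.
  by rewrite /e gt_min ltr_pdivrMr// ltr_pMr// ltr1n.
Qed.

Lemma cvg_primitive (w_ : nat -> R -> R) w (M : R) z : (forall n, continuous (w_ n)) ->
  continuous w -> 0 <= z ->
  (forall n t, 0 <= t <= z -> `|w_ n t| <= M) ->
  (forall t, 0 <= t <= z -> w_ n t @[n --> \oo] --> w t) ->
  primitive (w_ n) z @[n --> \oo] --> primitive w z.
Proof.
move=> cw_ cw z0 wM ww.
rewrite primitiveE// (_ : (fun n => _) =
   (fun n => \int[leb]_(t in `[0, z]) w_ n t)); last first.
  by apply/funext => n; rewrite primitiveE.
have mcont (f : R -> R) : continuous f -> measurable_fun `[0, z] (EFin \o f).
  by move=> cf; apply/measurable_EFinP/measurable_funTS; exact: continuous_measurable_fun.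
have [||||||ifi _ ] := @dominated_convergence _ _ _ leb `[0, z] _
   (fun n => EFin \o w_ n) (EFin \o w) (cst M%:E).
- exact: measurable_itv.
- by move=> n; exact: mcont.
- exact: mcont.
- apply/aeW => x; rewrite /= in_itv/= => /ww h.
  by apply: cvg_EFin; [exact: nearW|].
- apply: (@continuous_integrable_itv (cst M)); exact: cst_continuous.
- by apply/aeW => x n; rewrite /= in_itv/= => /wM; rewrite lee_fin.
move=> h; apply: fine_cvg; rewrite /Rintegral fineK//.
exact: integrable_fin_num ifi.
Qed.

End primitive.

(** * The recursion operator and the ratio order *)

Section recursion.
Context {R : realType} (lambda : R).
Hypothesis lambda_gt0 : 0 < lambda.
Implicit Types (h : R -> R) (z s t : R).

Lemma powRrE : powR lambda = fun t => expR (t * ln lambda).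
Proof. by apply/funext => t; rewrite /powR gt_eqF. Qed.

Lemma is_derive_powRr t :
  is_derive t 1 (powR lambda) (lambda `^ t * ln lambda).
Proof.
rewrite powRrE; apply: (@is_derive1_comp _ expR (fun t => t * ln lambda)).
rewrite -[X in is_derive _ _ _ X]mul1r.
under eq_fun do rewrite mulrC -[_ * _]/(_ *: _).
by rewrite mul1r -[X in is_derive _ _ _ X]mulr1; exact: is_deriveZ.
Qed.

Lemma continuous_powRr : continuous (powR lambda).
Proof.
move=> t; apply: differentiable_continuous; apply/derivable1_diffP.
by have [] := is_derive_powRr t.
Qed.

Lemma powRr_le t : 0 <= t <= 1 -> lambda `^ t <= 1 + lambda.
Proof.
move=> /andP[t0 t1]; have [l1|l1] := leP 1 lambda.
  apply: (@le_trans _ _ (lambda `^ 1)); first by rewrite ler_powR.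
  by rewrite powRr1 ?(ltW lambda_gt0)// lerDr.
apply: (@le_trans _ _ (lambda `^ 0)); last by rewrite powRr0 lerDl ltW.
by apply: ger_powR => //; rewrite lambda_gt0 ltW.
Qed.

(** Composing with the projection onto [0, 1] makes the laws continuous on the
    whole line, so that the recursion iterates without side conditions on
    domains. *)
Definition clamp z : R := Num.max 0 (Num.min z 1).

Lemma clamp_id z : 0 <= z <= 1 -> clamp z = z.
Proof. by move=> /andP[z0 z1]; rewrite /clamp (min_idPl z1) (max_idPr z0). Qed.

Lemma clamp_itv z : 0 <= clamp z <= 1.
Proof. by rewrite /clamp le_max lexx/= ge_max ler01 ge_min lexx orbT. Qed.

Lemma clamp_le0 z : z <= 0 -> clamp z = 0.
Proof.
by move=> z0; rewrite /clamp; apply/max_idPl; rewrite ge_min z0.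
Qed.

Lemma clamp_lipschitz s t : s <= t -> 0 <= clamp t - clamp s <= t - s.
Proof.
move=> st; rewrite /clamp; case: (leP s 1) => s1; case: (leP t 1) => t1;
  case: (leP 0 s) => s0; case: (leP 0 t) => t0; rewrite ?(max_idPr (@ler01 R)); lra.
Qed.

Lemma continuous_lipschitz (M : R) h :
  (forall s t, s <= t -> `|h t - h s| <= M * (t - s)) -> continuous h.
Proof.
move=> hM x; apply/(@cvgrPdist_lt R^o) => e e0.
have M0 : 0 <= M by have := hM 0 1 ler01; rewrite subr0 mulr1; exact: le_trans.
near=> y.
have H : `|h x - h y| <= M * `|x - y|.
  have [xy|yx] := leP x y; last by rewrite (ger0_norm (_ : 0 <= x - y)) ?hM// ?subr_ge0 ltW.
  by rewrite distrC (distrC x) (ger0_norm (_ : 0 <= y - x)) ?hM// subr_ge0.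
apply: (le_lt_trans H).
apply: (@le_lt_trans _ _ ((M + 1) * `|x - y|)); first by rewrite ler_wpM2r// lerDl.
rewrite mulrC -ltr_pdivlMr ?ltr_wpDl//.
near: y; apply: (@cvgr_dist_lt _ R^o); first exact: cvg_id.
by rewrite divr_gt0// ltr_wpDl.
Unshelve. all: by end_near. Qed.

Definition weight h t : R := lambda `^ t * h (1 - t).

Definition mass h : R := primitive (weight h) 1.

(** The law of a root spin t weighted by lambda^t and by the conditional
    probability h (1 - t) that all the children are compatible with it. *)
Definition root_law h z : R := primitive (weight h) (clamp z) / mass h.

(** Continuity rules out every atom except one at 0, so that the constant 1,
    the law of a spin forced to be 0, belongs to the class. *)
Record cdf01 h : Prop := Cdf01 {
  cdf01_cont : continuous h ;
  cdf01_ge0 : forall t, 0 <= t <= 1 -> 0 <= h t ;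
  cdf01_1 : h 1 = 1 ;
  cdf01_homo : forall s t, 0 <= s -> s <= t -> t <= 1 -> h s <= h t }.

Lemma cdf01_le1 h t : cdf01 h -> 0 <= t <= 1 -> h t <= 1.
Proof.
by move=> [_ _ h1 hh] /andP[t0 t1]; rewrite -[leRHS]h1 hh.
Qed.

(** The ratio h1 / h2 is nondecreasing, in a cross-multiplied form that makes
    sense where h2 vanishes; this is the reversed hazard rate order. *)
Definition ratio_le h1 h2 := forall s t, 0 <= s -> s <= t -> t <= 1 ->
  h1 s * h2 t <= h1 t * h2 s.

Lemma ratio_le_pointwise h1 h2 t : cdf01 h1 -> cdf01 h2 -> ratio_le h1 h2 ->
  0 <= t <= 1 -> h1 t <= h2 t.
Proof.
move=> [_ _ h11 _] [_ _ h21 _] h12 /andP[t0 t1].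
by have := h12 t 1 t0 t1 (lexx _); rewrite h11 h21 mulr1 mul1r.
Qed.

Lemma cdf01_cst1 : cdf01 (cst 1).
Proof. by split=> [|t _|//|s t _ _ _] /=; [exact: cst_continuous|exact: ler01|]. Qed.

Lemma ratio_le_cst1 h : cdf01 h -> ratio_le h (cst 1).
Proof. by move=> [_ _ _ hh] s t s0 st t1; rewrite /= !mulr1 hh. Qed.

Lemma cdf01_prod (I : finType) (h_ : I -> R -> R) : (forall i, cdf01 (h_ i)) ->
  cdf01 (fun t => \prod_i h_ i t).
Proof.
move=> ch; split.
- by apply: (continuous_big (@mul_continuous R)) => i _; exact: (cdf01_cont (ch i)).
- by move=> t t01; apply: prodr_ge0 => i _; exact: (cdf01_ge0 (ch i)).
- by rewrite big1// => i _; exact: (cdf01_1 (ch i)).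
- move=> s t s0 st t1; apply: ler_prod => i _.
  by rewrite (cdf01_ge0 (ch i)) ?s0 ?(le_trans st)//= (cdf01_homo (ch i)).
Qed.

Lemma ratio_le_prod (I : finType) (h1 h2 : I -> R -> R) :
  (forall i, cdf01 (h1 i)) -> (forall i, cdf01 (h2 i)) ->
  (forall i, ratio_le (h1 i) (h2 i)) ->
  ratio_le (fun t => \prod_i h1 i t) (fun t => \prod_i h2 i t).
Proof.
move=> c1 c2 h12 s t s0 st t1; rewrite -!big_split/=.
apply: ler_prod => i _; rewrite h12// mulr_ge0// cdf01_ge0//.
  by rewrite s0 (le_trans st).
by rewrite (le_trans s0).
Qed.

Section weight.
Variables (h : R -> R) (ch : cdf01 h).

Lemma continuous_weight : continuous (weight h).
Proof.
move=> t; apply: (@cvgM _ R^o); first exact: continuous_powRr.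
apply: (@continuous_comp _ _ _ (fun t => 1 - t) h); last exact: (cdf01_cont ch).
by apply: (@cvgB _ R^o); [exact: cvg_cst|exact: cvg_id].
Qed.

Lemma onem_itv t : 0 <= t <= 1 -> 0 <= 1 - t <= 1.
Proof. lra. Qed.

Lemma weight_ge0 t : 0 <= t <= 1 -> 0 <= weight h t.
Proof.
by move=> t01; rewrite mulr_ge0 ?powR_ge0// (cdf01_ge0 ch) ?onem_itv.
Qed.

Lemma weight0 : weight h 0 = 1.
Proof. by rewrite /weight powRr0 subr0 (cdf01_1 ch) mul1r. Qed.

Lemma weight_le t : 0 <= t <= 1 -> weight h t <= 1 + lambda.
Proof.
move=> t01; rewrite /weight -[leRHS]mulr1 ler_pM ?powR_ge0 ?powRr_le//.
  by rewrite (cdf01_ge0 ch) ?onem_itv.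
by rewrite (cdf01_le1 ch) ?onem_itv.
Qed.

Lemma primitive_weight_gt0 z : 0 < z -> z <= 1 -> 0 < primitive (weight h) z.
Proof.
move=> z0 z1; apply: primitive_gt0 => //; first exact: continuous_weight.
- by move=> t /andP[t0 tz]; rewrite weight_ge0// t0 (le_trans tz).
- by rewrite weight0.
Qed.

Lemma mass_gt0 : 0 < mass h.
Proof. exact: primitive_weight_gt0. Qed.

Lemma primitive_weight_homo s t : 0 <= s -> s <= t -> t <= 1 ->
  primitive (weight h) s <= primitive (weight h) t.
Proof.
move=> s0 st t1; apply: primitive_homo; first exact: continuous_weight.
  by rewrite s0.
by move=> x /andP[sx xt]; rewrite weight_ge0// (le_trans s0)//= (le_trans xt).
Qed.

Lemma primitive_weight_ge0 z : 0 <= z <= 1 -> 0 <= primitive (weight h) z.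
Proof.
by move=> /andP[z0 z1]; rewrite -[leLHS](primitive0 (weight h)) primitive_weight_homo.
Qed.

Lemma root_law_lipschitz s t : s <= t ->
  `|root_law h t - root_law h s| <= (1 + lambda) / mass h * (t - s).
Proof.
move=> st; rewrite /root_law -mulrBl.
have /andP[c0 c1] := clamp_lipschitz st.
have /andP[s0 s1] := clamp_itv s; have /andP[t0 t1] := clamp_itv t.
have cst : clamp s <= clamp t by rewrite -subr_ge0.
rewrite ger0_norm; last first.
  by rewrite divr_ge0 ?(ltW mass_gt0)// subr_ge0 primitive_weight_homo.
rewrite [leRHS]mulrAC ler_pM2r ?invr_gt0 ?mass_gt0//.
apply: (@le_trans _ _ ((1 + lambda) * (clamp t - clamp s))); last first.
  by rewrite ler_wpM2l// addr_ge0// ltW.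
apply: primitive_lipschitz; first exact: continuous_weight.
  by rewrite s0.
by move=> x /andP[sx xt]; rewrite weight_le// (le_trans s0)//= (le_trans xt).
Qed.

Lemma cdf01_root_law : cdf01 (root_law h).
Proof.
split.
- exact: continuous_lipschitz root_law_lipschitz.
- move=> t t01; rewrite /root_law divr_ge0 ?(ltW mass_gt0)//.
  by rewrite primitive_weight_ge0// clamp_itv.
- by rewrite /root_law clamp_id ?ler01 ?lexx// divff// gt_eqF// mass_gt0.
- move=> s t s0 st t1; rewrite /root_law ler_pM2r ?invr_gt0 ?mass_gt0//.
  by rewrite !clamp_id ?s0 ?t1 ?(le_trans s0) ?(le_trans st)// primitive_weight_homo.
Qed.

Lemma root_law_le0 z : z <= 0 -> root_law h z = 0.
Proof. by move=> z0; rewrite /root_law clamp_le0// primitive0 mul0r. Qed.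

End weight.

Lemma le_primitive_weight h1 h2 z : cdf01 h1 -> cdf01 h2 ->
  (forall t, 0 <= t <= 1 -> h1 t <= h2 t) -> 0 <= z <= 1 ->
  primitive (weight h1) z <= primitive (weight h2) z.
Proof.
move=> c1 c2 h12 /andP[z0 z1]; apply: le_primitive => //;
  try exact: continuous_weight.
move=> t /andP[t0 tz]; rewrite /weight ler_wpM2l ?powR_ge0// h12// onem_itv//.
by rewrite t0 (le_trans tz).
Qed.

(** The unnormalised primitives are ordered the other way, so the difference
    comes from the normalising masses alone and is largest at the right end. *)
Lemma root_law_gap h1 h2 z : cdf01 h1 -> cdf01 h2 ->
  (forall t, 0 <= t <= 1 -> h1 t <= h2 t) -> 0 <= z <= 1 ->
  root_law h1 z - root_law h2 z <= mass h2 / mass h1 - 1.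
Proof.
move=> c1 c2 h12 z01; rewrite /root_law clamp_id//.
have m1 := mass_gt0 c1; have m2 := mass_gt0 c2.
have le12 := le_primitive_weight c1 c2 h12 z01.
have le2 : primitive (weight h2) z <= mass h2.
  by case/andP: z01 => z0 z1; apply: primitive_weight_homo.
have m12 : mass h1 <= mass h2 by apply: le_primitive_weight => //; rewrite ler01 lexx.
apply: (@le_trans _ _ (primitive (weight h2) z * ((mass h1)^-1 - (mass h2)^-1))).
  by rewrite mulrBr lerB// ler_pM2r// invr_gt0.
rewrite -(divff (lt0r_neq0 m2)) -mulrBr ler_wpM2r// subr_ge0 lef_pV2//.
Qed.

(** Reflecting t into 1 - t reverses the monotone ratio of h1 and h2 in the
    densities. A monotone ratio of densities passes to the primitives by
    integrating the cross-multiplied inequality in each of its two variables in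
    turn; the normalising constants cancel. *)
Lemma root_law_antitone h1 h2 : cdf01 h1 -> cdf01 h2 -> ratio_le h1 h2 ->
  ratio_le (root_law h2) (root_law h1).
Proof.
move=> c1 c2 h12.
set W1 := primitive (weight h1); set W2 := primitive (weight h2).
have w21 s t : 0 <= s -> s <= t -> t <= 1 ->
    weight h2 s * weight h1 t <= weight h2 t * weight h1 s.
  move=> s0 st t1; rewrite /weight [leLHS]mulrACA [leRHS]mulrACA.
  rewrite (mulrC (lambda `^ t)) ler_wpM2l ?mulr_ge0 ?powR_ge0//.
  rewrite [leLHS]mulrC [leRHS]mulrC; apply: h12; lra.
have dW h (ch : cdf01 h) (x : R) : 0 <= x -> 
    is_derive x 1 (primitive (weight h)) (weight h x).
  move=> x0; apply: is_derive_primitive; first exact: continuous_weight.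
  by rewrite (lt_le_trans _ x0)// ltrN10.
have Ww s u : 0 <= s -> s <= u -> u <= 1 -> W2 s * weight h1 u <= weight h2 u * W1 s.
  move=> s0 su u1; rewrite -subr_ge0.
  have := ge0_derive_le (f := fun x => weight h2 u * W1 x - W2 x * weight h1 u)
    (df := fun x => weight h2 u * weight h1 x - weight h2 x * weight h1 u) s0.
  rewrite /W1 /W2 !primitive0 mulr0 mul0r subrr; apply.
  - move=> x /andP[x0 _]; apply: is_deriveB.
      by apply: (is_deriveZ (weight h2 u)); exact: dW.
    under eq_fun do rewrite mulrC.
    by rewrite [X in is_derive _ _ _ X]mulrC; apply: (is_deriveZ (weight h1 u)); exact: dW.
  - by move=> x /andP[x0 xs]; rewrite subr_ge0 w21// (le_trans xs).
have W21 s t : 0 <= s -> s <= t -> t <= 1 -> W2 s * W1 t <= W2 t * W1 s.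
  move=> s0 st t1; rewrite -subr_ge0.
  have := ge0_derive_le (f := fun x => W2 x * W1 s - W2 s * W1 x)
    (df := fun x => weight h2 x * W1 s - W2 s * weight h1 x) st.
  rewrite subrr; apply.
  - move=> x /andP[sx _]; apply: is_deriveB; last first.
      by apply: (is_deriveZ (W2 s)); apply: dW => //; exact: le_trans sx.
    under eq_fun do rewrite mulrC.
    rewrite [X in is_derive _ _ _ X]mulrC; apply: (is_deriveZ (W1 s)).
    by apply: dW => //; exact: le_trans sx.
  - by move=> x /andP[sx xt]; rewrite subr_ge0 Ww// (le_trans xt).
move=> s t s0 st t1; rewrite /root_law !clamp_id ?s0 ?t1 ?(le_trans s0) ?(le_trans st)//.
rewrite [leLHS]mulrACA [leRHS]mulrACA (mulrC (mass h2)^-1) ler_pM2r ?W21//.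
by rewrite mulr_gt0 ?invr_gt0 ?mass_gt0.
Qed.

End recursion.

(** * Integration against the free spin measure *)

Section integral_nu.
Context {R : realType} (lambda : R).
Local Notation leb := (@lebesgue_measure R).
Local Notation dens := (fun t : measurableTypeR R => (lambda `^ t)%:E).
Local Open Scope ereal_scope.

Let mdens D : measurable D -> measurable_fun D dens.
Proof.
by move=> mD; apply/measurable_EFinP; apply: measurable_funTS; exact: measurable_powRr.
Qed.

Let dens_ge0 t : 0 <= dens t. Proof. by rewrite lee_fin powR_ge0. Qed.

Let integral_nu_indic E : measurable E ->
  \int[nu lambda]_x (\1_E x)%:E =
  \int[leb]_(x in `[0%R, 1%R]) ((\1_E x)%:E * dens x).
Proof.
move=> mE; rewrite integral_indic// setIT [LHS]integral_mkcondl.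
apply: eq_integral => x _; rewrite patchE indicE.
by case: ifPn => xE; rewrite ?mul1e ?mul0e.
Qed.

Import HBNNSimple.

Let integral_nu_nnsfun (f : {nnsfun (measurableTypeR R) >-> R}) :
  \int[nu lambda]_x (f x)%:E =
  \int[leb]_(x in `[0%R, 1%R]) ((f x)%:E * dens x).
Proof.
under [LHS]eq_integral do rewrite fimfunE -fsumEFin//.
rewrite [LHS]ge0_integral_fsum//; last 2 first.
- by move=> r; exact/measurable_EFinP/measurableT_comp.
- by move=> n x _; rewrite EFinM nnfun_muleindic_ge0.
under [RHS]eq_integral.
  move=> x xD; rewrite fimfunE -fsumEFin// ge0_mule_fsuml; last first.
    by move=> r; rewrite EFinM nnfun_muleindic_ge0.
  over.
rewrite [RHS]ge0_integral_fsum//; last 2 first.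
- move=> r; apply: emeasurable_funM; last exact: mdens.
  by apply/measurable_EFinP; apply/measurableT_comp.
- by move=> r x _; rewrite mule_ge0// EFinM nnfun_muleindic_ge0.
apply: eq_fsbigr => r rf; rewrite integralZl_indic_nnsfun// integral_nu_indic//.
have r0 : (0 <= r)%R.
  by move: rf; rewrite inE => -[x _ <-].
rewrite -ge0_integralZl ?lee_fin//.
- by apply: eq_integral => x _; rewrite muleA.
- by apply: emeasurable_funM; [exact/measurable_EFinP|exact: mdens].
- by move=> x _; rewrite mule_ge0.
Qed.

(** By linearity and monotone convergence from the case of indicators. *)
Lemma ge0_integral_nu (f : measurableTypeR R -> \bar R) :
  measurable_fun setT f -> (forall x, 0 <= f x) ->
  \int[nu lambda]_x f x = \int[leb]_(x in `[0%R, 1%R]) (f x * dens x).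
Proof.
move=> mf f0.
pose f_ := nnsfun_approx measurableT mf.
have fcvg x : (f_ n x)%:E @[n --> \oo] --> f x by exact: cvg_nnsfun_approx.
transitivity (limn (fun n => \int[nu lambda]_x (f_ n x)%:E)).
  rewrite -monotone_convergence//=.
  - by apply: eq_integral => ? _; apply/esym/cvg_lim => //=.
  - by move=> n; exact/measurable_EFinP/measurable_funTS.
  - by move=> n ? _; rewrite lee_fin.
  - by move=> ? _ ? ? mn; rewrite lee_fin; exact/lefP/nd_nnsfun_approx.
under eq_fun do rewrite integral_nu_nnsfun.
rewrite -monotone_convergence//=.
- apply: eq_integral => x _; apply/cvg_lim => //=.
  by apply: cvgeZr => //; exact: fcvg.
- by move=> n; apply: emeasurable_funM; [exact/measurable_EFinP/measurable_funTS|exact: mdens].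
- by move=> n x _; rewrite mule_ge0// lee_fin.
- move=> x _ m n mn; rewrite lee_wpmul2r//.
  by rewrite lee_fin; exact/lefP/nd_nnsfun_approx.
Qed.

End integral_nu.

Section nu_primitive.
Context {R : realType} (lambda : R).
Hypothesis lambda_gt0 : 0 < lambda.
Local Notation leb := (@lebesgue_measure R).

Lemma itv01_setI (z : R) : z <= 1 ->
  `[0, z]%classic `&` `[0, 1]%classic = `[0, z]%classic :> set R.
Proof.
move=> z1; apply/setIidl/subset_itvl; rewrite bnd_simp//.
Qed.

Lemma Rintegral_nu (h : R -> R) z : continuous h -> 0 <= z <= 1 ->
  (forall t, 0 <= t <= z -> 0 <= h t) ->
  (\int[nu lambda]_(t in `[0%R, z]) h t)%R =
  primitive (fun t => lambda `^ t * h t) z.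
Proof.
move=> ch /andP[z0 z1] h0.
have cw : continuous (fun t => lambda `^ t * h t).
  by move=> t; apply: (@cvgM _ R^o); [exact: continuous_powRr|exact: ch].
rewrite primitiveE// /Rintegral; congr fine.
rewrite integral_mkcond ge0_integral_nu.
- rewrite [RHS]integral_mkcond [LHS]integral_mkcond.
  apply: eq_integral => x _; rewrite !patchE !mem_setE.
  case: ifPn => x01; last first.
    case: ifPn => // x0z; move: x01; rewrite !in_itv/= in x0z *.
    by move/andP: x0z => [-> xz]; rewrite (le_trans xz).
  by case: ifPn => xz; rewrite ?mul0e// -EFinM mulrC.
- apply/(measurable_restrictT _ _).1 => //.
  apply/measurable_EFinP/measurable_funTS; exact: continuous_measurable_fun.
- move=> x; rewrite patchE; case: ifPn => //.
  by rewrite mem_setE in_itv/= lee_fin; exact: h0.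
Qed.

Lemma nu_itv z : 0 <= z <= 1 ->
  fine (nu lambda `[0, z]%classic) = primitive (powR lambda) z.
Proof.
move=> /andP[z0 z1]; rewrite primitiveE//; last exact: continuous_powRr.
by rewrite /Rintegral /nu itv01_setI.
Qed.

End nu_primitive.

(** * Bracketing the root law of the tree *)

Section tree.
Context {R : realType} (lambda : R) (Delta : nat).
Hypothesis lambda_gt0 : 0 < lambda.
Local Notation step := (root_law lambda).
Local Notation pow h := (fun t => h t ^+ Delta).
Implicit Types (h : R -> R).

(** The two sequences are defined together because the operator exchanges
    lower and upper bounds. *)
Fixpoint bracket n : (R -> R) * (R -> R) :=
  if n is m.+1 then (step (pow (bracket m).2), step (pow (bracket m).1))
  else (step (cst 1), cst 1).

Definition lo n := (bracket n).1.
Definition hi n := (bracket n).2.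

Lemma powE h : pow h = (fun t => \prod_(i < Delta) h t).
Proof. by apply/funext => t; rewrite prodr_const card_ord. Qed.

Lemma cdf01_pow h : cdf01 h -> cdf01 (pow h).
Proof. by move=> ch; rewrite powE; apply: cdf01_prod. Qed.

Lemma ratio_le_pow h1 h2 : cdf01 h1 -> cdf01 h2 -> ratio_le h1 h2 ->
  ratio_le (pow h1) (pow h2).
Proof. by move=> c1 c2 h12; rewrite !powE; apply: ratio_le_prod. Qed.

Lemma step_pow_antitone h1 h2 : cdf01 h1 -> cdf01 h2 -> ratio_le h1 h2 ->
  ratio_le (step (pow h2)) (step (pow h1)).
Proof.
by move=> c1 c2 h12; apply: root_law_antitone; rewrite ?lambda_gt0//;
  [exact: cdf01_pow|exact: cdf01_pow|exact: ratio_le_pow].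
Qed.

Lemma cdf01_bracket n : cdf01 (lo n) /\ cdf01 (hi n).
Proof.
elim: n => [|n [IHl IHh]].
  by split; [apply: cdf01_root_law => //; exact: cdf01_cst1|exact: cdf01_cst1].
by split; apply: cdf01_root_law => //; exact: cdf01_pow.
Qed.

Lemma cdf01_lo n : cdf01 (lo n). Proof. by have [] := cdf01_bracket n. Qed.
Lemma cdf01_hi n : cdf01 (hi n). Proof. by have [] := cdf01_bracket n. Qed.
Hint Resolve cdf01_lo cdf01_hi : core.

Lemma ratio_le_bracket n : ratio_le (lo n) (hi n).
Proof.
elim: n => [|n IH]; first exact: ratio_le_cst1.
exact: (@step_pow_antitone (lo n) (hi n)).
Qed.

(** The initial pair is nested because the constant 1 is the top of the order
    and root_law (cst 1) is its image; antitonicity propagates the nesting. *)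
Lemma bracket_nested n :
  ratio_le (lo n) (lo n.+1) /\ ratio_le (hi n.+1) (hi n).
Proof.
elim: n => [|n [IHl IHh]].
  split; last exact: ratio_le_cst1.
  rewrite /lo/= (_ : pow (cst 1) = cst 1); last first.
    by apply/funext => t; rewrite /= expr1n.
  by move=> s t s0 st t1; rewrite mulrC.
split.
  exact: (@step_pow_antitone (hi n.+1) (hi n)).
exact: (@step_pow_antitone (lo n) (lo n.+1)).
Qed.

Lemma continuous_minl (a : R) : continuous (fun z => Num.min z a).
Proof.
apply: (@continuous_lipschitz _ 1) => s t st.
by rewrite mul1r !minEle; case: (leP t a); case: (leP s a) => sa ta;
  rewrite ger0_norm; lra.
Qed.

Lemma root_law_cst1E a z : 0 <= z <= 1 -> 0 <= a <= 1 ->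
  step (cst 1) z / step (cst 1) a =
  fine (nu lambda `[0, z]%classic) / fine (nu lambda `[0, a]%classic).
Proof.
move=> z01 a01; rewrite /root_law !clamp_id// !nu_itv//.
rewrite (_ : weight lambda (cst 1) = powR lambda); last first.
  by apply/funext => t; rewrite /weight mulr1.
by rewrite invf_div mulrA divfK// gt_eqF// mass_gt0//; exact: cdf01_cst1.
Qed.

(** Above leaves with maximum xbar the root law is the free law conditioned on
    [0, 1 - xbar]. The ratio of the free law to it is constant up to 1 - xbar
    and then proportional to the free law, hence nondecreasing. *)
Lemma hc_cdf1_bracket (x : leaf Delta 1 -> R) : boundary x ->
  exists h, [/\ cdf01 h, (forall z, 0 <= z <= 1 -> hc_cdf lambda x z = h z),
                ratio_le (lo 0) h & ratio_le h (hi 0)].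
Proof.
move=> bx; rewrite /hc_cdf/=; set xbar := \big[_/_]_w x w.
have xbar0 : 0 <= xbar by exact: bigmax_ge_id.
have [xbar1|_] := ltP xbar 1; last first.
  exists (cst 1); split=> //; first exact: cdf01_cst1.
  by apply: ratio_le_cst1; exact: (cdf01_lo 0).
pose a := 1 - xbar.
have a01 : 0 < a <= 1 by rewrite /a; lra.
have [a0 a1] := andP a01.
have [M ME] : exists M, M = lo 0 by exists (lo 0).
have cM : cdf01 M by rewrite ME.
have Ma0 : 0 < M a.
  rewrite ME /lo/= /root_law clamp_id ?(ltW a0)// divr_gt0 ?mass_gt0//; last exact: cdf01_cst1.
  by apply: primitive_weight_gt0 => //; exact: cdf01_cst1.
have min01 z : 0 <= z <= 1 -> 0 <= Num.min z a <= 1.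
  by move=> /andP[z0 z1]; rewrite le_min z0 (ltW a0) ge_min z1.
pose h z := M (Num.min z a) / M a.
have ch : cdf01 h.
  split.
  - move=> z; apply: (@cvgMl _ R^o).
    apply: (@continuous_comp _ _ _ (fun z => Num.min z a) M); first exact: continuous_minl.
    exact: (cdf01_cont cM).
  - by move=> t t01; rewrite /h divr_ge0 ?(ltW Ma0)// (cdf01_ge0 cM) ?min01.
  - by rewrite /h (min_idPr a1) divff// gt_eqF.
  - move=> s t s0 st t1; rewrite /h ler_pM2r ?invr_gt0//.
    apply: (cdf01_homo cM).
    + by rewrite le_min s0 ltW.
    + by rewrite le_min2.
    + by rewrite ge_min t1.
exists h; split => //; last exact: ratio_le_cst1.
  move=> z z01; rewrite /h ME root_law_cst1E//; first exact: min01.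
  by rewrite (ltW a0).
move=> s t s0 st t1; rewrite -ME.
rewrite /h !mulrA ler_pM2r ?invr_gt0//.
have Mge0 u : 0 <= u <= 1 -> 0 <= M u by exact: (cdf01_ge0 cM).
have Mhomo := cdf01_homo cM.
have [ta|ta] := leP t a.
  by rewrite (min_idPl (le_trans st ta)) mulrC.
have [sa|sa] := leP s a.
  rewrite mulrC ler_wpM2r ?Mge0 ?s0 ?(le_trans st)//.
  by apply: Mhomo => //; exact: ltW.
by rewrite ler_wpM2r ?(ltW Ma0)// Mhomo.
Qed.

Lemma root_cdfSE n (x : leaf Delta n.+2 -> R) (h : 'I_Delta -> R -> R) :
  (forall i, cdf01 (h i)) ->
  (forall i z, 0 <= z <= 1 -> hc_cdf lambda (subboundary x i) z = h i z) ->
  forall z, 0 <= z <= 1 -> hc_cdf lambda x z = step (fun t => \prod_i h i t) z.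
Proof.
move=> ch xh z z01; rewrite {1}/hc_cdf.
change (root_cdf (nu lambda) x z) with
  ((\int[nu lambda]_(t in `[0, z])
      \prod_(i < Delta) hc_cdf lambda (subboundary x i) (1 - t)) /
   (\int[nu lambda]_(t in `[0, 1])
      \prod_(i < Delta) hc_cdf lambda (subboundary x i) (1 - t))).
have E u : 0 <= u <= 1 ->
   \int[nu lambda]_(t in `[0, u])
     \prod_(i < Delta) hc_cdf lambda (subboundary x i) (1 - t) =
   primitive (weight lambda (fun t => \prod_i h i t)) u.
  move=> u01; have cp := cdf01_prod ch.
  rewrite -(Rintegral_nu lambda_gt0 (h := fun t => \prod_i h i (1 - t)))//.
  - apply: eq_Rintegral => t; rewrite inE/= in_itv/= => /andP[t0 tu].
    by apply: eq_bigr => i _; rewrite xh// onem_itv// t0 (le_trans tu)//; case/andP: u01.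
  - move=> t; have c1 : {for t, continuous (fun t : R => 1 - t)}.
      by apply: (@cvgB _ R^o); [exact: cvg_cst|exact: cvg_id].
    exact: (continuous_comp c1 (cdf01_cont cp (x := _))).
  - move=> t /andP[t0 tu]; apply: (cdf01_ge0 cp); rewrite onem_itv// t0 (le_trans tu)//.
    by case/andP: u01.
by rewrite !E ?ler01 ?lexx// /root_law clamp_id.
Qed.

Lemma boundary_sub n (x : leaf Delta n.+1 -> R) i :
  boundary x -> boundary (subboundary x i).
Proof. by move=> bx w; exact: bx. Qed.

Lemma hc_cdf_bracket n (x : leaf Delta n.+1 -> R) : boundary x ->
  exists h, [/\ cdf01 h, (forall z, 0 <= z <= 1 -> hc_cdf lambda x z = h z),
                ratio_le (lo n) h & ratio_le h (hi n)].
Proof.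
elim: n => [|n IH] in x *; first exact: hc_cdf1_bracket.
move=> bx.
have /choice[h hP] (i : 'I_Delta) := IH _ (@boundary_sub _ x i bx).
have ch i : cdf01 (h i) by have [] := hP i.
exists (step (fun t => \prod_i h i t)).
have cp := cdf01_prod ch.
split.
- exact: cdf01_root_law.
- by apply: root_cdfSE => // i; have [] := hP i.
- apply: root_law_antitone => //; first exact: (cdf01_pow (cdf01_hi n)).
  by rewrite powE; apply: (ratio_le_prod (h1 := h) (h2 := fun=> hi n)) => // i;
    have [] := hP i.
- apply: root_law_antitone => //; first exact: (cdf01_pow (cdf01_lo n)).
  by rewrite powE; apply: (ratio_le_prod (h1 := fun=> lo n) (h2 := h)) => // i;
    have [] := hP i.
Qed.

(** From depth 2 on, the root law has an explicit density, which the bounds at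
    the children control pointwise. *)
Lemma hc_cdf_root_law n (x : leaf Delta n.+2 -> R) : boundary x ->
  exists p, [/\ cdf01 p, (forall z, 0 <= z <= 1 -> hc_cdf lambda x z = step p z),
    (forall t, 0 <= t <= 1 -> lo n t ^+ Delta <= p t) &
    (forall t, 0 <= t <= 1 -> p t <= hi n t ^+ Delta)].
Proof.
move=> bx.
have /choice[h hP] (i : 'I_Delta) := hc_cdf_bracket (@boundary_sub _ x i bx).
have ch i : cdf01 (h i) by have [] := hP i.
exists (fun t => \prod_i h i t); split.
- exact: cdf01_prod.
- by apply: root_cdfSE => // i; have [] := hP i.
- move=> t t01; rewrite -[in leLHS](card_ord Delta) -prodr_const ler_prod// => i _.
  by rewrite (cdf01_ge0 (cdf01_lo n))//= ratio_le_pointwise//; have [] := hP i.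
- move=> t t01; rewrite -[in leRHS](card_ord Delta) -prodr_const ler_prod// => i _.
  by rewrite (cdf01_ge0 (ch i))//= ratio_le_pointwise//; have [] := hP i.
Qed.

End tree.

(** * Two-cycles are fixed points *)

Section two_cycle.
Context {R : realType} (lambda : R) (Delta : nat).
Hypothesis lambda_gt0 : 0 < lambda.
Local Notation step := (root_law lambda).
Local Notation pow h := (fun t => h t ^+ Delta).
Implicit Types (h : R -> R).

Lemma is_derive1M (f g : R -> R) (x a b : R) :
  is_derive x 1 f a -> is_derive x 1 g b ->
  is_derive x 1 (fun y => f y * g y) (a * g x + f x * b).
Proof.
move=> fa gb; have := is_deriveM fa gb.
by rewrite addrC [g x *: a]mulrC.
Qed.

Lemma is_derive1X (f : R -> R) n (x a : R) :
  is_derive x 1 f a ->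
  is_derive x 1 (fun y => f y ^+ n.+1) (n.+1%:R * f x ^+ n * a).
Proof. by move=> fa; have := is_deriveX n.+1 fa; rewrite exprfctE. Qed.

Lemma is_derive_onem (x : R) : is_derive x 1 (fun y => 1 - y) (-1).
Proof. by rewrite -[X in is_derive _ _ _ X]add0r; apply: is_deriveB. Qed.

Lemma is_derive_primitive_weight h (z : R) : cdf01 h -> -1 < z ->
  is_derive z 1 (primitive (weight lambda h)) (weight lambda h z).
Proof.
by move=> ch z1; apply: is_derive_primitive => //; exact: continuous_weight.
Qed.

Section energy.
Variables f g : R -> R.
Hypotheses (cf : cdf01 f) (cg : cdf01 g).
Hypotheses (fE : forall z, 0 <= z <= 1 -> f z = step (pow g) z).
Hypotheses (gE : forall z, 0 <= z <= 1 -> g z = step (pow f) z).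

Let A := (mass lambda (pow g))^-1.
Let B := (mass lambda (pow f))^-1.
(* Extensions of f and g that are differentiable past both endpoints. *)
Let f' z := primitive (weight lambda (pow g)) z * A.
Let g' z := primitive (weight lambda (pow f)) z * B.

Let energy z := A * (lambda `^ z * g' (1 - z) ^+ Delta.+1)
  + B * (lambda `^ (1 - z) * f' z ^+ Delta.+1) - ln lambda * (f' z * g' (1 - z)).

Let f'E z : 0 <= z <= 1 -> f' z = f z.
Proof. by move=> z01; rewrite fE// /root_law clamp_id. Qed.

Let g'E z : 0 <= z <= 1 -> g' z = g z.
Proof. by move=> z01; rewrite gE// /root_law clamp_id. Qed.

(* The terms coming from the derivatives of lambda^z, lambda^(1-z) and f k
   cancel in pairs, and so do those from f^(Delta+1) and k^(Delta+1). *)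
Let is_derive_energy (z : R) : 0 <= z <= 1 -> is_derive z 1 energy 0.
Proof.
move=> z01; have [z0 z1] := andP z01.
have cpf := cdf01_pow Delta cf; have cpg := cdf01_pow Delta cg.
have df : is_derive z 1 f' (weight lambda (pow g) z * A).
  have h := @is_derive_primitive_weight _ z cpg ltac:(lra).
  have := is_derive1M h (is_derive_cst A z 1).
  by rewrite mulr0 addr0.
have dg : is_derive z 1 (fun z => g' (1 - z)) (weight lambda (pow f) (1 - z) * B * -1).
  have h : is_derive (1 - z) 1 g' (weight lambda (pow f) (1 - z) * B).
    have h := @is_derive_primitive_weight _ (1 - z) cpf ltac:(lra).
    have := is_derive1M h (is_derive_cst B (1 - z) 1).
    by rewrite mulr0 addr0.
  exact: (@is_derive1_comp _ g' (fun y => 1 - y) _ _ _ h (is_derive_onem z)).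
have dl := is_derive_powRr lambda_gt0 z.
have dl' := @is_derive1_comp _ (powR lambda) (fun y => 1 - y) _ _ _
  (is_derive_powRr lambda_gt0 (1 - z)) (is_derive_onem z).
have dE := is_deriveB (is_deriveD
    (is_deriveZ A (is_derive1M dl (is_derive1X Delta dg)))
    (is_deriveZ B (is_derive1M dl' (is_derive1X Delta df))))
  (is_deriveZ (ln lambda) (is_derive1M df dg)).
apply: (is_derive_eq dE).
rewrite /= /weight subKr g'E ?onem_itv// f'E//.
rewrite /GRing.scale/= !exprS; ring.
Qed.

(** The conserved energy takes the values 1 / mass (g^Delta) at 0 and
    1 / mass (f^Delta) at 1. *)
Lemma two_cycle_mass_eq : mass lambda (pow f) = mass lambda (pow g).
Proof.
have E01 : energy 0 = energy 1.
  apply/eqP; rewrite eq_le; apply/andP; split.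
    by apply: (ge0_derive_le (df := fun=> 0) ler01) => // x x01; exact: is_derive_energy.
  rewrite -lerN2.
  apply: (ge0_derive_le (f := fun x => - energy x) (df := fun=> 0) ler01) => // x x01.
  by rewrite -oppr0; apply: is_deriveN; exact: is_derive_energy.
have f0 : f 0 = 0 by rewrite fE ?lexx ?ler01// root_law_le0.
have g0 : g 0 = 0 by rewrite gE ?lexx ?ler01// root_law_le0.
move: E01; rewrite /energy subr0 subrr !f'E ?g'E ?lexx ?ler01//.
rewrite f0 g0 (cdf01_1 cf) (cdf01_1 cg) !powRr0 !expr1n
   !exprS !mul0r !mulr0 !subr0 !addr0 !mulr1 add0r.
by move/invr_inj.
Qed.

End energy.

End two_cycle.

(** * Limits of the bracketing sequences *)

Section limit.
Context {R : realType} (lambda : R) (Delta : nat).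
Hypothesis lambda_gt0 : 0 < lambda.
Local Notation step := (root_law lambda).
Local Notation pow h := (fun t => h t ^+ Delta).
Local Notation lo := (lo lambda Delta).
Local Notation hi := (hi lambda Delta).
Implicit Types (h : R -> R).

Let cdf01_lo n : cdf01 (lo n). Proof. exact: cdf01_lo. Qed.
Let cdf01_hi n : cdf01 (hi n). Proof. exact: cdf01_hi. Qed.
Hint Resolve cdf01_lo cdf01_hi : core.

Lemma le_bracket n t : 0 <= t <= 1 -> lo n t <= hi n t.
Proof. by move=> t01; apply: ratio_le_pointwise => //; exact: ratio_le_bracket. Qed.

Lemma nondecreasing_lo t : 0 <= t <= 1 -> nondecreasing_seq (fun n => lo n t).
Proof.
move=> t01; apply/nondecreasing_seqP => n.
by apply: ratio_le_pointwise => //; have [] := bracket_nested Delta lambda_gt0 n.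
Qed.

Lemma nonincreasing_hi t : 0 <= t <= 1 -> nonincreasing_seq (fun n => hi n t).
Proof.
move=> t01; apply/nonincreasing_seqP => n.
by apply: ratio_le_pointwise => //; have [] := bracket_nested Delta lambda_gt0 n.
Qed.

Definition lo_lim z := limn (fun n => lo n (clamp z)).
Definition hi_lim z := limn (fun n => hi n (clamp z)).

Lemma cvg_lo t : 0 <= t <= 1 -> lo n t @[n --> \oo] --> lo_lim t.
Proof.
move=> t01; rewrite /lo_lim clamp_id//; apply: nondecreasing_is_cvgn.
  exact: nondecreasing_lo.
by exists 1 => _ [n _ <-]; exact: cdf01_le1.
Qed.

Lemma cvg_hi t : 0 <= t <= 1 -> hi n t @[n --> \oo] --> hi_lim t.
Proof.
move=> t01; rewrite /hi_lim clamp_id//; apply: nonincreasing_is_cvgn.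
  exact: nonincreasing_hi.
by exists 0 => _ [n _ <-]; exact: cdf01_ge0.
Qed.

Lemma lo_lim_clamp z : lo_lim z = lo_lim (clamp z).
Proof. by rewrite /lo_lim [clamp (clamp _)]clamp_id ?clamp_itv. Qed.

Lemma hi_lim_clamp z : hi_lim z = hi_lim (clamp z).
Proof. by rewrite /hi_lim [clamp (clamp _)]clamp_id ?clamp_itv. Qed.

(* All the laws but hi 0 have a normalising mass bounded below by that of
   lo(0)^Delta, which makes K a common Lipschitz constant. *)
Let K := (1 + lambda) / mass lambda (pow (lo 0)).

Let mass0_gt0 : 0 < mass lambda (pow (lo 0)).
Proof. by apply: mass_gt0 => //; exact: cdf01_pow. Qed.

Let K_gt0 : 0 < K. Proof. by rewrite divr_gt0// addr_gt0. Qed.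

Lemma step_lipschitz_lo0 h s t : cdf01 h ->
  (forall t, 0 <= t <= 1 -> lo 0 t ^+ Delta <= h t) -> s <= t ->
  `|step h t - step h s| <= K * (t - s).
Proof.
move=> ch l0h st; apply: (le_trans (root_law_lipschitz lambda_gt0 ch st)).
rewrite ler_wpM2r ?subr_ge0// /K ler_wpM2l ?addr_ge0 ?(ltW lambda_gt0)//.
have mh := mass_gt0 lambda_gt0 ch.
rewrite lef_pV2 ?posrE//; apply: le_primitive_weight => //.
  exact: cdf01_pow.
by rewrite ler01 lexx.
Qed.

Lemma pow_le h1 h2 t : 0 <= h1 t -> h1 t <= h2 t -> h1 t ^+ Delta <= h2 t ^+ Delta.
Proof. by move=> h0 h12; rewrite lerXn2r// nnegrE// (le_trans h0). Qed.

Lemma bracket_lipschitz n s t : s <= t ->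
  `|lo n t - lo n s| <= K * (t - s) /\ `|hi n t - hi n s| <= K * (t - s).
Proof.
move=> st.
have lo0 t' : 0 <= t' <= 1 -> 0 <= lo 0 t' by exact: cdf01_ge0.
have lo0n m t' : 0 <= t' <= 1 -> lo 0 t' <= lo m t'.
  by move=> t01; apply: (nondecreasing_lo t01).
case: n => [|n]; split.
- apply: step_lipschitz_lo0 => //; first exact: cdf01_cst1.
  by move=> t' t01; rewrite exprn_ile1 ?lo0//; exact: cdf01_le1.
- by rewrite /= subrr normr0 mulr_ge0 ?(ltW K_gt0)// subr_ge0.
- apply: step_lipschitz_lo0 => //; first exact: (cdf01_pow Delta (cdf01_hi n)).
  by move=> t' t01; apply: pow_le; rewrite ?lo0// (le_trans (lo0n n _ t01))// le_bracket.
- apply: step_lipschitz_lo0 => //; first exact: (cdf01_pow Delta (cdf01_lo n)).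
  by move=> t' t01; apply: pow_le; rewrite ?lo0// lo0n.
Qed.

Lemma cdf01_cvg (h_ : nat -> R -> R) h : (forall n, cdf01 (h_ n)) ->
  (forall n s t, s <= t -> `|h_ n t - h_ n s| <= K * (t - s)) ->
  (forall z, h z = h (clamp z)) ->
  (forall t, 0 <= t <= 1 -> h_ n t @[n --> \oo] --> h t) -> cdf01 h.
Proof.
move=> ch hK hclamp hcvg; split.
- apply: (@continuous_lipschitz _ K) => s t st.
  have /andP[c0 c1] := clamp_lipschitz st.
  apply: (@le_trans _ _ (K * (clamp t - clamp s))); last by rewrite ler_pM2l.
  rewrite hclamp (hclamp s).
  have ht := hcvg _ (clamp_itv t); have hs := hcvg _ (clamp_itv s).
  apply: (ler_cvg_to (cvg_norm (cvgB ht hs)) (cvg_cst (K * (clamp t - clamp s)))).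
  by apply: nearW => n; apply: hK; rewrite -subr_ge0.
- move=> t t01; apply: (cvgr_to_ge (hcvg _ t01)).
  by apply: nearW => n; exact: cdf01_ge0.
- apply: (cvg_unique (@Rhausdorff R)) (hcvg 1 _) _; first by rewrite ler01 lexx.
  rewrite (_ : (fun n => _) = cst 1); first exact: cvg_cst.
  by apply/funext => n; exact: cdf01_1.
- move=> s t s0 st t1; have s01 : 0 <= s <= 1 by rewrite s0 (le_trans st).
  have t01 : 0 <= t <= 1 by rewrite (le_trans s0).
  apply: (ler_cvg_to (hcvg _ s01) (hcvg _ t01)).
  by apply: nearW => n; exact: cdf01_homo.
Qed.

Lemma cdf01_lo_lim : cdf01 lo_lim.
Proof.
apply: (cdf01_cvg cdf01_lo) => [n s t st||t t01]; last exact: cvg_lo.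
- by have [] := bracket_lipschitz n st.
- exact: lo_lim_clamp.
Qed.

Lemma cdf01_hi_lim : cdf01 hi_lim.
Proof.
apply: (cdf01_cvg cdf01_hi) => [n s t st||t t01]; last exact: cvg_hi.
- by have [] := bracket_lipschitz n st.
- exact: hi_lim_clamp.
Qed.

Section step_cvg.
Variables (h_ : nat -> R -> R) (h : R -> R).
Hypotheses (ch_ : forall n, cdf01 (h_ n)) (ch : cdf01 h).
Hypothesis hcvg : forall t, 0 <= t <= 1 -> h_ n t @[n --> \oo] --> h t.

Lemma cvg_primitive_weight_pow z : 0 <= z <= 1 ->
  primitive (weight lambda (pow (h_ n))) z @[n --> \oo] -->
  primitive (weight lambda (pow h)) z.
Proof.
move=> /andP[z0 z1]; apply: (@cvg_primitive _ _ _ (1 + lambda)) => //.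
- by move=> n; apply: continuous_weight => //; exact: cdf01_pow.
- by apply: continuous_weight => //; exact: cdf01_pow.
- move=> n t /andP[t0 tz]; have t01 : 0 <= t <= 1 by rewrite t0 (le_trans tz).
  have cp := cdf01_pow Delta (ch_ n).
  by rewrite ger0_norm ?weight_ge0// weight_le.
- move=> t /andP[t0 tz]; have t01 : 0 <= t <= 1 by rewrite t0 (le_trans tz).
  apply: cvgM; first exact: cvg_cst.
  exact: (cvg_comp _ _ (hcvg (onem_itv t01)) (@exprn_continuous R Delta (h (1 - t)))).
Qed.

Lemma cvg_mass_pow :
  mass lambda (pow (h_ n)) @[n --> \oo] --> mass lambda (pow h).
Proof. by apply: cvg_primitive_weight_pow; rewrite ler01 lexx. Qed.

Lemma cvg_step_pow z : step (pow (h_ n)) z @[n --> \oo] --> step (pow h) z.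
Proof.
apply: cvgM; first exact: cvg_primitive_weight_pow (clamp_itv z).
apply: cvgV; last exact: cvg_mass_pow.
by rewrite gt_eqF// mass_gt0//; exact: cdf01_pow.
Qed.

End step_cvg.

Lemma lo_lim_fix z : lo_lim z = step (pow hi_lim) z.
Proof.
rewrite lo_lim_clamp.
have := cvg_lo (clamp_itv z); rewrite -cvg_shiftS/= => lim1.
have lim2 := cvg_step_pow cdf01_hi cdf01_hi_lim cvg_hi (z := clamp z).
rewrite (cvg_unique (@Rhausdorff R) lim1 lim2).
by rewrite /root_law (clamp_id (clamp_itv z)).
Qed.

Lemma hi_lim_fix z : hi_lim z = step (pow lo_lim) z.
Proof.
rewrite hi_lim_clamp.
have := cvg_hi (clamp_itv z); rewrite -cvg_shiftS/= => lim1.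
have lim2 := cvg_step_pow cdf01_lo cdf01_lo_lim cvg_lo (z := clamp z).
rewrite (cvg_unique (@Rhausdorff R) lim1 lim2).
by rewrite /root_law (clamp_id (clamp_itv z)).
Qed.

(** The pointwise inequality between the two limits is reversed by the
    recursion once their normalising masses agree. *)
Lemma lo_lim_eq_hi_lim : lo_lim = hi_lim.
Proof.
have lohi t : 0 <= t <= 1 -> lo_lim t <= hi_lim t.
  move=> t01; apply: (ler_cvg_to (cvg_lo t01) (cvg_hi t01)).
  by apply: nearW => n; exact: le_bracket.
have cl := cdf01_lo_lim; have cu := cdf01_hi_lim.
have massE := two_cycle_mass_eq lambda_gt0 cl cu
  (fun z _ => lo_lim_fix z) (fun z _ => hi_lim_fix z).
apply/funext => z; apply/eqP; rewrite eq_le; apply/andP; split.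
  by rewrite lo_lim_clamp hi_lim_clamp lohi// clamp_itv.
rewrite lo_lim_fix hi_lim_fix /root_law massE ler_pM2r; last first.
  by rewrite invr_gt0 mass_gt0//; exact: cdf01_pow.
apply: le_primitive_weight; rewrite ?clamp_itv//; [exact: cdf01_pow|exact: cdf01_pow|].
by move=> t t01; rewrite pow_le ?lohi//; exact: cdf01_ge0.
Qed.

End limit.

(** * Derivatives relative to [0, 1] and suprema *)

Section derivative01.
Context {R : realType}.
Implicit Types f W : R -> R.

Lemma subrXX_le (a b : R) k : 0 <= a -> a <= b -> b <= 1 ->
  b ^+ k - a ^+ k <= k%:R * (b - a).
Proof.
move=> a0 ab b1; elim: k => [|k IH]; first by rewrite !expr0 subrr mul0r.
have -> : b ^+ k.+1 - a ^+ k.+1 = b * (b ^+ k - a ^+ k) + a ^+ k * (b - a).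
  by rewrite !exprS; ring.
rewrite -natr1 mulrDl mul1r lerD//.
  have akbk : 0 <= b ^+ k - a ^+ k by rewrite subr_ge0 lerXn2r// nnegrE// (le_trans a0).
  by apply: le_trans IH; rewrite ler_piMl.
have ak1 : a ^+ k <= 1 by rewrite exprn_ile1// (le_trans ab).
by rewrite ler_piMl// subr_ge0.
Qed.

Lemma within01_proper (z : R) : 0 <= z <= 1 ->
  ProperFilter (within `[0, 1]%classic z^').
Proof.
move=> /andP[z0 z1]; split; last exact: within_filter.
rewrite /within/= => /nbhs_ballP[d /= d0 dP].
pose e := Num.min (d / 2) (1 / 2).
have e0 : 0 < e by rewrite lt_min !divr_gt0.
have ed : e < d by rewrite gt_min ltr_pdivrMr// ltr_pMr// ltr1n.
have e12 : e <= 1 / 2 by rewrite ge_min lexx orbT.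
have [zh|zh] := leP z (1 / 2).
- apply: (dP (z + e)).
  + by rewrite /ball/= opprD addrA subrr sub0r normrN gtr0_norm.
  + by rewrite -subr_eq0 addrAC subrr add0r gt_eqF.
  + by rewrite /= in_itv/=; apply/andP; split; lra.
- apply: (dP (z - e)).
  + by rewrite /ball/= opprB addrC subrK gtr0_norm.
  + by rewrite -subr_eq0 addrAC subrr add0r oppr_eq0 gt_eqF.
  + by rewrite /= in_itv/=; apply/andP; split; lra.
Qed.

Lemma cvg_quotient01 f W (z d : R) : 0 <= z <= 1 ->
  (forall y, 0 <= y <= 1 -> f y = W y) -> is_derive z 1 W d ->
  quotient01 f z --> d.
Proof.
move=> z01 fW [dW Wd].
have FF := within01_proper z01.
apply/cvgrPdist_lt => e e0.
have /cvgrPdist_lt/(_ e e0) : h^-1 *: ((W \o shift z) (h *: 1) - W z) @[h --> 0^'] --> d.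
  by rewrite -Wd; exact: dW.
rewrite /dnbhs near_withinE => /nbhs_ballP[r /= r0 rP].
rewrite /within/=; apply/nbhs_ballP; exists r => //= y zy yz.
rewrite in_itv/= => y01; rewrite !fW//.
have := rP (y - z).
rewrite /ball/= sub0r normrN distrC => /(_ zy).
rewrite subr_eq0 => /(_ yz).
by rewrite /= [_ *: 1]mulr1 subrK [_ *: _]mulrC.
Qed.

Lemma derivable01P f W (z d : R) : 0 <= z <= 1 ->
  (forall y, 0 <= y <= 1 -> f y = W y) -> is_derive z 1 W d ->
  derivable01 f z /\ derive01 f z = d.
Proof.
move=> z01 fW Wd; have H := cvg_quotient01 z01 fW Wd.
have FF := within01_proper z01.
split; first by apply/cvg_ex; exists d.
exact: cvg_lim H.
Qed.

Lemma esup0_le (T : Type) (A : set T) (g : T -> \bar R) (c : \bar R) :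
  (0 <= c)%E -> (forall x, A x -> (g x <= c)%E) -> (0 <= esup0 A g <= c)%E.
Proof.
move=> c0 gc; apply/andP; split.
  by apply: ereal_sup_ubound; left.
by apply: ge_ereal_sup => _ [->//|[x Ax <-]]; exact: gc.
Qed.

Lemma cvg_shifted_squeeze0 (e : nat -> \bar R) (b : nat -> R) k :
  (forall n, (0 <= e (n + k)%N <= (b n)%:E)%E) ->
  b n @[n --> \oo] --> (0 : R) -> e n @[n --> \oo] --> 0%E.
Proof.
move=> eb b0; have bE0 : (b n)%:E @[n --> \oo] --> 0%E.
  by apply: cvg_EFin => //; exact: nearW.
have : [sequence e (n + k)%N]_n @ \oo --> 0%E.
  have eb' : \forall n \near \oo, (0 <= e (n + k)%N <= (b n)%:E)%E by exact: nearW.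
  exact: (squeeze_cvge eb' (cvg_cst _) bE0).
by rewrite cvg_shiftn.
Qed.

End derivative01.

(** * Uniform convergence *)

Section convergence.
Context {R : realType} (lambda : R) (Delta : nat).
Hypothesis lambda_gt0 : 0 < lambda.
Hypothesis Delta_gt0 : (0 < Delta)%N.
Local Notation step := (root_law lambda).
Local Notation pow h := (fun t => h t ^+ Delta).
Local Notation lo := (lo lambda Delta).
Local Notation hi := (hi lambda Delta).
Local Notation l := (lo_lim lambda Delta).

Let cl : cdf01 l. Proof. exact: cdf01_lo_lim. Qed.
Let cpl : cdf01 (pow l). Proof. exact: cdf01_pow. Qed.
Let cpow n : cdf01 (pow (lo n)) /\ cdf01 (pow (hi n)).
Proof. by split; apply: cdf01_pow; [exact: cdf01_lo|exact: cdf01_hi]. Qed.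

Lemma lim_fix z : l z = step (pow l) z.
Proof. by rewrite {1}(lo_lim_eq_hi_lim Delta lambda_gt0) hi_lim_fix. Qed.

Definition limit_density z := weight lambda (pow l) z / mass lambda (pow l).
Definition limit_cdf z := primitive (weight lambda (pow l)) z / mass lambda (pow l).

Lemma limit_cdfE z : 0 <= z <= 1 -> limit_cdf z = l z.
Proof. by move=> z01; rewrite lim_fix /root_law clamp_id. Qed.

(** Beyond 1 the density vanishes, since the limit law is 0 on the negative
    half-line and Delta > 0. *)
Lemma limit_density_ge0 z : 0 <= z -> 0 <= limit_density z.
Proof.
move=> z0; apply: divr_ge0; last exact: ltW (mass_gt0 lambda_gt0 cpl).
have [z1|z1] := leP z 1; first by rewrite weight_ge0// z0.
rewrite /weight (_ : l (1 - z) = 0) ?expr0n ?gtn_eqF ?mulr0//.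
by rewrite lim_fix root_law_le0// subr_le0 ltW.
Qed.

Lemma is_derive_step (h : R -> R) (z : R) : cdf01 h -> -1 < z ->
  is_derive z 1 (fun y => primitive (weight lambda h) y / mass lambda h)
    (weight lambda h z / mass lambda h).
Proof.
move=> ch z1.
have := is_derive1M (is_derive_primitive_weight lambda_gt0 ch z1)
  (is_derive_cst (mass lambda h)^-1 z 1).
by rewrite mulr0 addr0.
Qed.

Lemma continuous_limit_density : continuous limit_density.
Proof.
by move=> z; apply: cvgM; [exact: continuous_weight|exact: cvg_cst].
Qed.

Lemma lo_le_lim n t : 0 <= t <= 1 -> lo n t <= l t.
Proof.
move=> t01; have := cvg_lo (Delta := Delta) lambda_gt0 t01 => H.
rewrite -(cvg_lim (@Rhausdorff R) H); apply: nondecreasing_cvgn_le.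
  exact: nondecreasing_lo.
exact: cvgP H.
Qed.

Lemma lim_le_hi n t : 0 <= t <= 1 -> l t <= hi n t.
Proof.
move=> t01; have := cvg_hi (Delta := Delta) lambda_gt0 t01 => H.
rewrite (lo_lim_eq_hi_lim Delta lambda_gt0).
rewrite -(cvg_lim (@Rhausdorff R) H); apply: nonincreasing_cvgn_ge.
  exact: nonincreasing_hi.
exact: cvgP H.
Qed.

(** A bound on hi (n+1) - lo (n+1) that is uniform on [0, 1]. *)
Definition gap n := mass lambda (pow (hi n)) / mass lambda (pow (lo n)) - 1.

Lemma cvg_mass_lo : mass lambda (pow (lo n)) @[n --> \oo] --> mass lambda (pow l).
Proof.
apply: cvg_mass_pow => //; first exact: cdf01_lo.
by move=> t; exact: cvg_lo.
Qed.

Lemma cvg_mass_hi : mass lambda (pow (hi n)) @[n --> \oo] --> mass lambda (pow l).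
Proof.
apply: cvg_mass_pow => //; first exact: cdf01_hi.
by move=> t; rewrite (lo_lim_eq_hi_lim Delta lambda_gt0); exact: cvg_hi.
Qed.

Let mass_l_neq0 : mass lambda (pow l) != 0.
Proof. by rewrite gt_eqF// mass_gt0. Qed.

Lemma cvg_gap : gap n @[n --> \oo] --> (0 : R).
Proof.
rewrite -(subrr 1) -[X in X - _](divff mass_l_neq0); apply: cvgB; last exact: cvg_cst.
by apply: cvgM; [exact: cvg_mass_hi|apply: cvgV => //; exact: cvg_mass_lo].
Qed.

Lemma hi_lo_gap n z : 0 <= z <= 1 -> hi n.+1 z - lo n.+1 z <= gap n.
Proof.
move=> z01; have [c1 c2] := cpow n.
apply: (root_law_gap lambda_gt0 c1 c2) => // t t01; apply: pow_le.
  by apply: (cdf01_ge0 (cdf01_lo Delta lambda_gt0 n)).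
exact: le_bracket.
Qed.

Lemma gap_ge0 n : 0 <= gap n.
Proof.
apply: le_trans (hi_lo_gap n _ (z := 0)); last by rewrite lexx ler01.
by rewrite subr_ge0 le_bracket// lexx ler01.
Qed.

Lemma hc_cdf_dist n (x : leaf Delta n.+2 -> R) z : boundary x -> 0 <= z <= 1 ->
  `|hc_cdf lambda x z - limit_cdf z| <= gap n.
Proof.
move=> bx z01; rewrite limit_cdfE//.
have [h [ch -> // lh hh]] := hc_cdf_bracket lambda_gt0 bx.
have lh' := ratio_le_pointwise (cdf01_lo Delta lambda_gt0 _) ch lh z01.
have hh' := ratio_le_pointwise ch (cdf01_hi Delta lambda_gt0 _) hh z01.
have ll := lo_le_lim n.+1 z01; have lh2 := lim_le_hi n.+1 z01.
have := hi_lo_gap n z01; rewrite ler_norml.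
move: lh' hh' ll lh2; move: (lo _ _) (hi _ _) (h z) (l z) (gap n) => *; lra.
Qed.

Definition density_gap n := (1 + lambda) *
  (Delta%:R * gap n / mass lambda (pow (lo n.+1))
  + ((mass lambda (pow (lo n.+1)))^-1 - (mass lambda (pow (hi n.+1)))^-1)).

Lemma cvg_density_gap : density_gap n @[n --> \oo] --> (0 : R).
Proof.
have H1 : (mass lambda (pow (lo n.+1)))^-1 @[n --> \oo] --> (mass lambda (pow l))^-1.
  apply: cvgV => //; have := cvg_mass_lo; rewrite -cvg_shiftS; exact.
have H2 : (mass lambda (pow (hi n.+1)))^-1 @[n --> \oo] --> (mass lambda (pow l))^-1.
  apply: cvgV => //; have := cvg_mass_hi; rewrite -cvg_shiftS; exact.
have -> : 0 = (1 + lambda) * (Delta%:R * 0 / mass lambda (pow l) +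
    ((mass lambda (pow l))^-1 - (mass lambda (pow l))^-1)).
  by rewrite mulr0 mul0r subrr addr0 mulr0.
apply: cvgM; first exact: cvg_cst.
apply: cvgD; last exact: cvgB H1 H2.
by apply: cvgM H1; apply: cvgM; [exact: cvg_cst|exact: cvg_gap].
Qed.

Lemma le_mass h1 h2 : cdf01 h1 -> cdf01 h2 ->
  (forall t, 0 <= t <= 1 -> h1 t <= h2 t) -> mass lambda h1 <= mass lambda h2.
Proof.
by move=> c1 c2 h12; apply: le_primitive_weight => //; rewrite ler01 lexx.
Qed.

Lemma ler_div2 (a b A B : R) : 0 <= a -> a <= b -> 0 < A -> A <= B ->
  a / B <= b / A.
Proof.
move=> a0 ab A0 AB; have B0 := lt_le_trans A0 AB.
by apply: ler_pM => //; rewrite ?invr_ge0 ?(ltW B0)// lef_pV2.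
Qed.

(** Numerators and normalising masses are both monotone in the weight, hence
    the opposite pairing of the two bounds. *)
Lemma density_squeeze n p z : cdf01 p ->
  (forall t, 0 <= t <= 1 -> lo n.+1 t ^+ Delta <= p t) ->
  (forall t, 0 <= t <= 1 -> p t <= hi n.+1 t ^+ Delta) -> 0 <= z <= 1 ->
  weight lambda (pow (lo n.+1)) z / mass lambda (pow (hi n.+1)) <=
    weight lambda p z / mass lambda p <=
  weight lambda (pow (hi n.+1)) z / mass lambda (pow (lo n.+1)).
Proof.
move=> cp lp ph z01; have [c1 c2] := cpow n.+1.
have m1 := mass_gt0 lambda_gt0 c1; have m2 := mass_gt0 lambda_gt0 c2.
have mp := mass_gt0 lambda_gt0 cp.
have l1 := le_mass c1 cp lp; have l2 := le_mass cp c2 ph.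
have z01' := onem_itv z01.
have w1 : weight lambda (pow (lo n.+1)) z <= weight lambda p z.
  by rewrite /weight ler_wpM2l ?powR_ge0 ?lp.
have w2 : weight lambda p z <= weight lambda (pow (hi n.+1)) z.
  by rewrite /weight ler_wpM2l ?powR_ge0 ?ph.
apply/andP; split.
- exact: ler_div2 (weight_ge0 lambda c1 z01) w1 mp l2.
- exact: ler_div2 (weight_ge0 lambda cp z01) w2 m1 l1.
Qed.

Lemma density_dist n p z : cdf01 p ->
  (forall t, 0 <= t <= 1 -> lo n.+1 t ^+ Delta <= p t) ->
  (forall t, 0 <= t <= 1 -> p t <= hi n.+1 t ^+ Delta) -> 0 <= z <= 1 ->
  `|weight lambda p z / mass lambda p - limit_density z| <= density_gap n.
Proof.
move=> cp lp ph z01.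
have := density_squeeze cp lp ph z01.
have : weight lambda (pow (lo n.+1)) z / mass lambda (pow (hi n.+1)) <=
    limit_density z <=
  weight lambda (pow (hi n.+1)) z / mass lambda (pow (lo n.+1)).
  apply: density_squeeze => // t t01; apply: pow_le.
  - exact: (cdf01_ge0 (cdf01_lo Delta lambda_gt0 _)).
  - exact: lo_le_lim.
  - exact: (cdf01_ge0 cl).
  - exact: lim_le_hi.
have [c1 c2] := cpow n.+1; have z01' := onem_itv z01.
have m1 := mass_gt0 lambda_gt0 c1; have m2 := mass_gt0 lambda_gt0 c2.
have m12 : mass lambda (pow (lo n.+1)) <= mass lambda (pow (hi n.+1)).
  apply: le_mass => // t t01; apply: pow_le; last exact: le_bracket.
  exact: (cdf01_ge0 (cdf01_lo Delta lambda_gt0 _)).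
set A := mass _ _ in m1 m12 *; set B := mass _ _ in m2 m12 *.
set a := weight _ _ _; set b := weight lambda (pow (hi n.+1)) _.
have ba : b - a <= (1 + lambda) * (Delta%:R * gap n).
  rewrite /a /b /weight -mulrBr ler_pM ?powR_ge0 ?powRr_le//.
    rewrite subr_ge0 pow_le ?le_bracket//.
    exact: (cdf01_ge0 (cdf01_lo Delta lambda_gt0 _)).
  apply: le_trans (subrXX_le _ _ _ _) _.
  - exact: (cdf01_ge0 (cdf01_lo Delta lambda_gt0 _)).
  - exact: le_bracket.
  - exact: cdf01_le1 (cdf01_hi Delta lambda_gt0 _) _.
  - by rewrite ler_wpM2l ?hi_lo_gap.
have := weight_le lambda_gt0 c1 z01; rewrite -/a => a1.
have AB : 0 <= A^-1 - B^-1.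
  by rewrite subr_ge0 -[leLHS]mul1r -[leRHS]mul1r; exact: ler_div2 ler01 (lexx 1) m1 m12.
rewrite /density_gap -/A -/B; move: (gap n) ba => g ba.
move: (weight _ _ _ / _) (limit_density z) => u v.
clearbody a b A B => av au.
have : b / A - a / B <= (1 + lambda) * (Delta%:R * g / A + (A^-1 - B^-1)).
  have -> : b / A - a / B = (b - a) / A + a * (A^-1 - B^-1) by ring.
  rewrite [leRHS]mulrDr lerD//; last by rewrite ler_wpM2r.
  by rewrite mulrA ler_wpM2r// invr_ge0 ltW.
move: (b / A) (a / B) (_ * _) av au => *; rewrite ler_norml; lra.
Qed.

End convergence.

Theorem theorem3p1 (R : realType) (Delta : nat) (lambda : R)
    (hDelta : (1 <= Delta)%N) (hlambda : 0 < lambda) :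
  exists F : R -> R,
    [/\ (forall y z : R, 0 <= y -> y <= z -> F y <= F z),
        F 0 = 0,
        (forall z : R, 0 < z ->
           derivable F z 1 /\ {for z, continuous (derive1 F)}),
        derivable01 F 0 &
        forall K : set R, compact K -> K `<=` `[0, 1] ->
          (esup0 [set x : leaf Delta n -> R | boundary x] (fun x =>
             esup0 `[0, 1] (fun z =>
               `|hc_cdf lambda x z - F z|%:E))) @[n --> \oo] --> 0%E /\
          (esup0 [set x : leaf Delta n -> R | boundary x] (fun x =>
             esup0 K (fun z =>
               `|derive01 (hc_cdf lambda x) z - derive01 F z|%:E)))
             @[n --> \oo] --> 0%E].
Proof.
have cpl := cdf01_pow Delta (cdf01_lo_lim Delta hlambda).
pose F := limit_cdf lambda Delta.
have dF (z : R) : -1 < z -> is_derive z 1 F (limit_density lambda Delta z).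
  by move=> z1; exact: is_derive_step.
have dF01 (z : R) : 0 <= z <= 1 ->
    derivable01 F z /\ derive01 F z = limit_density lambda Delta z.
  move=> z01; apply: (@derivable01P _ F F) => //; apply: dF.
  by case/andP: z01 => z0 _; rewrite (lt_le_trans _ z0)// ltrN10.
exists F; split.
- move=> y z y0 yz.
  apply: (ge0_derive_le (df := limit_density lambda Delta)) => // x /andP[yx _].
    by apply: dF; rewrite (lt_le_trans _ (le_trans y0 yx))// ltrN10.
  by apply: limit_density_ge0 => //; exact: le_trans yx.
- by rewrite /F /limit_cdf primitive0 mul0r.
- move=> z z0; have dz := dF z (lt_trans (ltrN10 R) z0).
  split; first by have [] := dz.
  have near_eq : \forall y \near z, limit_density lambda Delta y = derive1 F y.
    near=> y; have y0 : -1 < y.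
      by near: y; apply: lt_nbhsr; exact: lt_trans (ltrN10 R) z0.
    by rewrite derive1E; have [_ ->] := dF y y0.
  have := @continuous_limit_density _ lambda Delta hlambda z.
  rewrite /continuous_at (nbhs_singleton near_eq); apply: cvg_trans.
  exact: near_eq_cvg.
- by have [] := dF01 0; rewrite ?lexx ?ler01.
- move=> K _ K01; split.
  + apply: (@cvg_shifted_squeeze0 _ _ (gap lambda Delta) 2); last exact: cvg_gap.
    * move=> n; rewrite addn2.
      have g0 : (0 <= (gap lambda Delta n)%:E)%E by rewrite lee_fin gap_ge0.
      apply: esup0_le => // x bx.
      suff /andP[] : (0 <= esup0 `[0%R, 1%R] (fun z => `|hc_cdf lambda x z - F z|%:E)
        <= (gap lambda Delta n)%:E)%E by [].
      apply: esup0_le => // z; rewrite /= in_itv/= => z01.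
      by rewrite lee_fin; exact: hc_cdf_dist.
  + apply: (@cvg_shifted_squeeze0 _ _ (density_gap lambda Delta) 3); last exact: cvg_density_gap.
    * move=> n; rewrite addn3.
      have bnd (x : leaf Delta n.+3 -> R) z : boundary x -> 0 <= z <= 1 ->
         `|derive01 (hc_cdf lambda x) z - derive01 F z| <= density_gap lambda Delta n.
        move=> bx z01; have [p [cp px lp ph]] := hc_cdf_root_law hlambda bx.
        have [_ ->] := dF01 z z01.
        have z1 : -1 < z by case/andP: z01 => z0 _; rewrite (lt_le_trans _ z0)// ltrN10.
        have dW := is_derive_step hlambda cp z1.
        have xW y : 0 <= y <= 1 ->
            hc_cdf lambda x y = primitive (weight lambda p) y / mass lambda p.
          by move=> y01; rewrite px// /root_law clamp_id.
        have [_ ->] := derivable01P z01 xW dW.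
        exact: density_dist.
      (* The zero boundary condition shows that the bound is nonnegative. *)
      have g0 : (0 <= (density_gap lambda Delta n)%:E)%E.
        rewrite lee_fin; apply: le_trans (bnd (fun=> 0) 0 _ _) => //.
          by move=> w; rewrite in_itv/= lexx ler01.
        by rewrite lexx ler01.
      apply: esup0_le => // x bx.
      suff /andP[] : (0 <= esup0 K (fun z => `|derive01 (hc_cdf lambda x) z - derive01 F z|%:E)
        <= (density_gap lambda Delta n)%:E)%E by [].
      apply: esup0_le => // z /K01; rewrite /= in_itv/= => z01.
      by rewrite lee_fin; exact: bnd.
Unshelve. all: by end_near. Qed.
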